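(* Let $\varepsilon > 0$ and let $\mathcal{P}:[0,1]\to\mathbb{C}_n[t]$ be a polynomial path. Then there is a $\delta > 0$ such that for any polynomial path $\mathcal{P}':[0,1]\to\mathbb{C}_n[t]$ with $\|\mathcal{P}_\alpha - \mathcal{P}'_\alpha\| < \delta$ for all $\alpha \in [0,1]$ and any $\mathcal{P}'$-root-path set $\{\gamma_1', \ldots, \gamma_n'\}$, there is a $\mathcal{P}$-root-path set $\{\gamma_1, \ldots, \gamma_n\}$ satisfying $|\gamma_j(\alpha) - \gamma_j'(\alpha)| < \varepsilon$ for all $\alpha \in [0,1]$ and all $j=1,\ldots,n$.
   Context: $\mathbb{C}_n[t]$ is the set of monic univariate complex polynomials of degree $n$. For a polynomial $Q=\sum_{j=0}^n a_jt^j$, $\|Q\|=\max_j|a_j|$. A polynomial path is a continuous function $\mathcal{P}:[0,1]\to\mathbb{C}_n[t]$, with value $\mathcal{P}_\alpha$ at $\alpha$. $\Sigma(Q)$ denotes the size-$n$ multiset of roots of a degree-$n$ polynomial $Q$ (with multiplicity). A $\mathcal{P}$-root-path set is a multiset $\{\gamma_1,\ldots,\gamma_n\}$ of continuous functions $[0,1]\to\mathbb{C}$ such that $\Sigma(\mathcal{P}_\alpha)=\{\gamma_1(\alpha),\ldots,\gamma_n(\alpha)\}$ as multisets for all $\alpha\in[0,1]$. *)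

(* Defs.v *)
From HB Require Import structures.
From mathcomp Require Import all_boot all_order all_algebra.
From mathcomp Require Import finmap multiset.
From mathcomp Require Import complex.
From mathcomp Require Import all_classical all_reals all_analysis.

Set Implicit Arguments.
Unset Strict Implicit.
Unset Printing Implicit Defensive.

Import Order.TTheory GRing.Theory Num.Theory.
Import numFieldNormedType.Exports.

Local Open Scope classical_set_scope.
Local Open Scope ring_scope.
Local Open Scope complex_scope.

Section PolynomialPaths.
Variable R : realType.
Implicit Types (P : R -> {poly R[i]}) (Q : {poly R[i]}).

(* [Normc.normc] is the modulus with values in [R]; the norm [`|z|] of [R[i]]
   takes values in [R[i]] and equals [(Normc.normc z)%:C]. *)
Definition polynorm Q : R := \big[Num.max/0]_(i < size Q) Normc.normc Q`_i.

(* Paths are total functions on [R] of which only the values on [[0, 1]]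
   matter. The space of monic polynomials of degree [n] carries the metric
   induced by [polynorm]. *)
Definition polynomial_path (n : nat) P : Prop :=
  (forall a : R, a \in `[0, 1] -> P a \is monic /\ size (P a) = n.+1) /\
  (forall a : R, a \in `[0, 1] ->
     polynorm (P b - P a) @[b --> within `[0, 1] (nbhs a)] --> (0 : R)).

Definition root_mset Q : {mset R[i]}%mset :=
  seq_mset (sval (closed_field_poly_normal Q)).

Lemma root_msetE Q (z : R[i]) : Q != 0 -> root_mset Q z = mup z Q.
Proof.
move=> Q0; rewrite /root_mset mset_seqE.
case: closed_field_poly_normal => r /= Qr; rewrite [in RHS]Qr.
rewrite -mul_polyC mupMr ?mu_prod_XsubC //.
by rewrite rootC lead_coef_eq0.
Qed.

(* The multiset of paths is given by an enumeration [g] of its [n] members. *)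
Definition root_path_set (n : nat) P (g : 'I_n -> R -> R[i]) : Prop :=
  (forall j : 'I_n, {within `[0, 1], continuous (g j : R -> (R[i] : numFieldType))}) /\
  (forall a : R, a \in `[0, 1] ->
     root_mset (P a) = seq_mset [seq g j a | j <- enum 'I_n]).

End PolynomialPaths.

(* Main.v *)
Require Import Defs.
From mathcomp Require Import all_boot all_order all_algebra.
From mathcomp Require Import finmap multiset.
From mathcomp Require Import complex ring lra.
From mathcomp Require Import all_classical all_reals all_analysis.
Import Order.TTheory GRing.Theory Num.Theory.
Local Open Scope ring_scope.

(** A continuous root path cannot move far while the polynomial barely moves:
    it stays in a union of [n] small discs around the roots of the nearby
    polynomial, hence (intermediate values and pigeonhole) it travels at most
    [O(n)] times their radius. So if the theorem failed, root paths [g_k] of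
    polynomial paths converging uniformly to [P] would be asymptotically
    equicontinuous and, as in the Arzela-Ascoli theorem, would converge
    uniformly on [[0, 1]] along an ultrafilter. The limits are continuous, and
    passing to the limit in [P_k = \prod_j ('X - g_k j)] shows that they form a
    root path set of [P], which is a contradiction. Existence of root paths of
    [P] is thus not needed beforehand. *)

Section RootPaths.
Variable R : realType.
Implicit Types (z w : R[i]) (p q : {poly R[i]}) (s : seq R[i]).
Import Normc numFieldNormedType.Exports.
Local Open Scope classical_set_scope.
Local Open Scope ring_scope.
Local Open Scope complex_scope.

(** * The modulus on [R[i]] and the coefficient norm on polynomials *)

Lemma normC_normc z : `|z| = (normc z)%:C.
Proof. by case: z. Qed.

Lemma normc_ge0 z : 0 <= normc z.
Proof. by case: z => a b /=; exact: sqrtr_ge0. Qed.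

Lemma normcX z m : normc (z ^+ m) = normc z ^+ m.
Proof.
by elim: m => [|m IH]; rewrite ?expr0 ?normc1 // !exprS normcM IH.
Qed.

Lemma normc_subC z w : normc (z - w) = normc (w - z).
Proof. by rewrite -opprB normcN. Qed.

Lemma normc_triangle u z w : normc (z - w) <= normc (z - u) + normc (u - w).
Proof. by rewrite -[z - w](subrKA u); exact: le_normcD. Qed.

Lemma normc_sum m (f : 'I_m -> R[i]) :
  normc (\sum_i f i) <= \sum_i normc (f i).
Proof.
elim: m f => [|m IH] f; first by rewrite !big_ord0 normc0.
by rewrite !big_ord_recr /=; apply: (le_trans (le_normcD _ _)); rewrite lerD2r.
Qed.

Lemma polynorm_ge0 p : 0 <= polynorm p.
Proof. exact: bigmax_ge_id. Qed.

Lemma coef_le_polynorm p k : normc p`_k <= polynorm p.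
Proof.
have [kp|pk] := ltnP k (size p); last by rewrite nth_default // normc0 polynorm_ge0.
exact: (le_bigmax _ (fun i : 'I_(size p) => normc p`_i) (Ordinal kp)).
Qed.

Lemma polynorm_le p (M : R) :
  0 <= M -> (forall k, normc p`_k <= M) -> polynorm p <= M.
Proof. by move=> M0 pM; apply: bigmax_le => // k _; exact: pM. Qed.

Lemma polynormD p q : polynorm (p + q) <= polynorm p + polynorm q.
Proof.
apply: polynorm_le => [|k]; first by rewrite addr_ge0 ?polynorm_ge0.
by rewrite coefD (le_trans (le_normcD _ _)) // lerD // coef_le_polynorm.
Qed.

Lemma polynormN p : polynorm (- p) = polynorm p.
Proof.
rewrite /polynorm size_polyN; apply: eq_bigr => i _.
by rewrite coefN normcN.
Qed.

(** * Size and location of roots *)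

Lemma normc_horner_le p z m (B : R) : (size p <= m.+1)%N ->
  1 <= B -> normc z <= B -> normc p.[z] <= polynorm p * (m.+1%:R * B ^+ m).
Proof.
move=> pm B1 zB; rewrite (horner_coef_wide _ pm).
apply: (le_trans (normc_sum _ _)).
have -> : polynorm p * (m.+1%:R * B ^+ m) = \sum_(i < m.+1) polynorm p * B ^+ m.
  by rewrite sumr_const card_ord -mulr_natl; ring.
apply: ler_sum => i _; rewrite normcM normcX ler_pM ?exprn_ge0 ?normc_ge0 //.
  exact: coef_le_polynorm.
rewrite (le_trans (y := B ^+ i)) //.
  by rewrite lerXn2r // nnegrE ?normc_ge0 // (le_trans ler01).
by rewrite ler_weXn2l // -ltnS.
Qed.

(** A crude Cauchy bound: if [normc z > 1], the leading term [z ^+ m] equals minus the sum of the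
    [m] lower ones, each at most [polynorm p * normc z ^+ m.-1]; divide by that power. *)
Lemma normc_root_le p z m : p \is monic -> size p = m.+1 -> root p z ->
  normc z <= 1 + m%:R * polynorm p.
Proof.
move=> pm sp /rootP; rewrite (horner_coef_wide _ (eq_leq sp)) big_ord_recr /=.
have -> : p`_m = 1 by move: pm; rewrite monicE lead_coefE sp => /eqP.
rewrite mul1r => /eqP; rewrite addrC addr_eq0 => /eqP /(congr1 (@normc R)).
rewrite normcN normcX => zm.
have [z1|z1] := leP (normc z) 1.
  by rewrite ler_wpDr // mulr_ge0 ?polynorm_ge0.
rewrite ler_wpDl //; case: m => [|m] in sp zm *.
  by move: zm; rewrite big_ord0 expr0 normc0 => /eqP; rewrite oner_eq0.
have z0 : 0 < normc z ^+ m by rewrite exprn_gt0 // (lt_trans ltr01).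
rewrite -(ler_pM2r z0) -exprS zm; apply: (le_trans (normc_sum _ _)).
have -> : m.+1%:R * polynorm p * normc z ^+ m =
    \sum_(i < m.+1) polynorm p * normc z ^+ m.
  by rewrite sumr_const card_ord -mulr_natl; ring.
apply: ler_sum => i _; rewrite normcM normcX ler_pM ?exprn_ge0 ?normc_ge0 //.
  exact: coef_le_polynorm.
by rewrite ler_weXn2l ?ltW // -ltnS.
Qed.

(** If all factors [z - x] had modulus at least [rho], the product would have modulus at least
    [rho ^+ size s]. *)
Lemma near_root_of_small_prod s z (rho : R) : 0 < rho ->
  normc (\prod_(x <- s) ('X - x%:P)).[z] < rho ^+ size s ->
  exists2 x, x \in s & normc (z - x) < rho.
Proof.
move=> rho0; apply: contraPP => far; apply/negP; rewrite -leNgt.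
have {}far x : x \in s -> rho <= normc (z - x).
  by move=> xs; rewrite leNgt; apply/negP => zx; apply: far; exists x.
elim: s far => [|x s IH] far; first by rewrite big_nil hornerE normc1.
rewrite big_cons hornerM normcM exprS ler_pM ?exprn_ge0 ?(ltW rho0) //.
  by rewrite !hornerE far ?mem_head.
by apply: IH => y ys; apply: far; rewrite inE ys orbT.
Qed.

(** At a root [z] of [q], [p.[z] = (p - q).[z]] is small, so [z] is near some root of [p].
    Multiplicities are not matched: only confinement to the discs is claimed. *)
Lemma roots_upper_semicontinuous p s (rho : R) :
  p = \prod_(x <- s) ('X - x%:P) -> 0 < rho ->
  exists2 d : R, 0 < d & forall q z, q \is monic -> size q = size p ->
    polynorm (p - q) < d -> root q z ->
    exists2 x, x \in s & normc (z - x) < rho.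
Proof.
move=> ps rho0; set m := size s.
have sp : size p = m.+1 by rewrite ps size_prod_XsubC.
(* Bounds the roots of every admissible [q] at once, because [polynorm (p - q) < 1] gives
   [polynorm q <= polynorm p + 1]. *)
pose B := 1 + m%:R * (polynorm p + 1).
have B1 : 1 <= B by rewrite lerDl mulr_ge0 // addr_ge0 ?polynorm_ge0.
have C0 : 0 < m.+1%:R * B ^+ m :> R.
  by rewrite mulr_gt0 // ?exprn_gt0 ?(lt_le_trans ltr01).
(* The second entry makes [normc (p - q).[z]] less than [rho ^+ m]. *)
exists (Num.min 1 (rho ^+ m / (m.+1%:R * B ^+ m))).
  by rewrite lt_min ltr01 divr_gt0 ?exprn_gt0.
move=> q z qm sq; rewrite lt_min => /andP[pq1 pq] qz.
have zB : normc z <= B.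
  rewrite (le_trans (normc_root_le _ _ _ qm (etrans sq sp) qz)) //.
  rewrite lerD2l ler_wpM2l // -[q](subKr p).
  by rewrite (le_trans (polynormD _ _)) // polynormN lerD2l ltW.
apply: near_root_of_small_prod => //; rewrite -ps.
have -> : p.[z] = (p - q).[z] by rewrite hornerD hornerN (rootP qz) subr0.
apply: le_lt_trans (normc_horner_le _ _ m B _ B1 zB) _.
  by rewrite (leq_trans (size_polyD _ _)) // size_polyN sq sp maxnn.
by rewrite -ltr_pdivlMr.
Qed.

(** * Root multisets as factorizations into linear factors *)

Lemma root_mset_prod s :
  root_mset (\prod_(x <- s) ('X - x%:P)) = seq_mset s.
Proof.
apply/msetP => z; rewrite root_msetE ?mu_prod_XsubC ?mset_seqE //.
by rewrite monic_neq0 // monic_prod_XsubC.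
Qed.

Lemma prod_of_root_mset p s : p \is monic -> root_mset p = seq_mset s ->
  p = \prod_(x <- s) ('X - x%:P).
Proof.
move=> /eqP pm; rewrite /root_mset; case: closed_field_poly_normal => r /= pr.
move=> /eq_seq_msetP rs; rewrite pr pm scale1r; exact: perm_big.
Qed.


(** * Oscillation of root paths *)

(** Positive elements of [R[i]] are real, so it is enough to test convergence with [e] in [R]. *)
Lemma cvg_normcP {T : Type} {F : set_system T} {FF : Filter F}
    (f : T -> R[i]) (l : R[i]) :
  f @ F --> (l : (R[i] : numFieldType)) <->
  forall e : R, 0 < e -> \forall t \near F, normc (l - f t) < e.
Proof.
have fP := @cvgrPdist_lt R[i] (R[i] : numFieldType) T F FF f l.
split=> [/fP fl e e0|fl].
  have := fl e%:C; rewrite ltcR => /(_ e0); apply: filterS => t.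
  by rewrite normC_normc ltcR.
apply/fP => e e0; have eE : e = (complex.Re e)%:C by rewrite RRe_real ?gtr0_real.
have := fl (complex.Re e); rewrite -ltcR -eE => /(_ e0); apply: filterS => t.
by rewrite -ltcR -eE normC_normc.
Qed.

(* Otherwise [`|h t - h a|] takes the [size s + 1] values [3 * rho * k], and two
   of the corresponding points of the path share a disc of radius [rho]. *)
Lemma path_oscillation (h : R -> R[i]) (a b rho : R) s : a <= b ->
  {within `[a, b], continuous (h : R -> (R[i] : numFieldType))} -> 0 < rho ->
  (forall t, t \in `[a, b] -> exists2 x, x \in s & normc (h t - x) < rho) ->
  normc (h b - h a) <= 3 * rho * (size s)%:R.
Proof.
move=> ab /subspace_continuousP ch rho0 near_s.
pose phi t := normc (h t - h a).
have cphi : {within `[a, b], continuous phi}.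
  apply/subspace_continuousP => x /ch /cvg_normcP cx.
  apply/cvgrPdist_lt => e /cx; apply: filterS => y; apply: le_lt_trans.
  have := normc_triangle (h x) (h y) (h a); have := normc_triangle (h y) (h x) (h a).
  rewrite (normc_subC (h y) (h x)) ler_norml /phi => *.
  by rewrite /= /from_subspace; apply/andP; split; lra.
rewrite leNgt; apply/negP => big.
have tE (k : 'I_(size s).+1) :
    exists c, c \in `[a, b] /\ phi c = 3 * rho * k%:R.
  have [] := @IVT R phi a b (3 * rho * k%:R) ab cphi.
    rewrite /phi subrr normc0 (min_l (normc_ge0 _)) (max_r (normc_ge0 _)).
    apply/andP; split; first by rewrite !mulr_ge0 // ltW.
    apply: ltW; apply: le_lt_trans big.
    by rewrite ler_wpM2l ?mulr_ge0 ?(ltW rho0) // ler_nat -ltnS.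
  by move=> c cab cv; exists c.
have /choice[t tP] := tE.
have xE (k : 'I_(size s).+1) :
    exists x, x \in s /\ normc (h (t k) - x) < rho.
  by have [x] := near_s _ (tP k).1; exists x.
have /choice[x xP] := xE.
(* Points sharing a disc are less than [2 * rho] apart, which is below the gap [3 * rho] between
   values of [phi]. *)
have key (i j : 'I_(size s).+1) : x i = x j -> (i <= j)%N.
  move=> xij; rewrite leqNgt; apply/negP => ji.
  have := normc_triangle (h (t j)) (h (t i)) (h a).
  rewrite -!/(phi _) (tP i).2 (tP j).2.
  have := normc_triangle (x i) (h (t i)) (h (t j)).
  have := (xP i).2; have := (xP j).2; rewrite -xij normc_subC.
  have : j.+1%:R <= i%:R :> R by rewrite ler_nat.
  rewrite -natr1; move: (j%:R : R) (i%:R : R) => u v uv *.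
  have : rho * (u + 1) <= rho * v by rewrite ler_wpM2l // ltW.
  by lra.
have injx : injective x.
  by move=> i j xij; apply/val_inj/eqP; rewrite eqn_leq !key.
have ux : uniq [seq x k | k <- enum 'I_(size s).+1].
  by rewrite map_inj_uniq ?enum_uniq.
suff /(uniq_leq_size ux) : {subset [seq x k | k <- enum 'I_(size s).+1] <= s}.
  by rewrite size_map size_enum_ord ltnn.
by move=> _ /mapP[k _ ->]; exact: (xP k).1.
Qed.

(** This is the asymptotic equicontinuity at [a]: [d] and [eta] are chosen before [P'] and [g'].
    Near [a] the roots of [P' t] stay in discs around the roots of [P a], and [path_oscillation]
    applies. *)
Lemma root_path_modulus n (P : R -> {poly R[i]}) (a e : R) :
  polynomial_path n P -> a \in `[0, 1] -> 0 < e ->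
  exists d eta : R, [/\ 0 < d, 0 < eta &
    forall P' (g' : 'I_n -> R -> R[i]), polynomial_path n P' ->
    (forall t, t \in `[0, 1] -> polynorm (P t - P' t) < d) ->
    root_path_set P' g' ->
    forall b j, b \in `[0, 1] -> `|a - b| < eta ->
      normc (g' j b - g' j a) < e].
Proof.
move=> [Pm Pc] a01 e0.
have [/eqP lPa sPa] := Pm a a01.
have [s Ps] := closed_field_poly_normal (P a); rewrite lPa scale1r in Ps.
have ss : size s = n by move: sPa; rewrite Ps size_prod_XsubC => -[].
(* With this radius the oscillation bound is [e * (n / n.+1) < e]; using [n.+1] also keeps the
   radius positive when [n = 0]. *)
have rho0 : 0 < e / (3 * n.+1%:R) by rewrite divr_gt0 ?mulr_gt0.
have [d d0 dP] := roots_upper_semicontinuous _ _ _ Ps rho0.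
(* One half of [d] is spent on [P a - P t], the other on [P t - P' t]. *)
have d20 : 0 < d / 2 by rewrite divr_gt0.
have /cvgrPdist_lt /(_ _ d20) := Pc a a01.
rewrite near_withinE => /nbhs_normP[eta /= eta0 etaP].
exists (d / 2), eta; split => // P' g' [P'm _] PP' [g'c g'P].
have close t j : t \in `[0, 1] -> `|a - t| < eta ->
    exists2 x, x \in s & normc (g' j t - x) < e / (3 * n.+1%:R).
  move=> t01 at_; have [P'tm sP't] := P'm t t01.
  apply: (dP (P' t)); rewrite ?sP't ?sPa //.
    have /= := etaP t at_ t01; rewrite sub0r normrN ger0_norm ?polynorm_ge0 //.
    have := PP' t t01; have := polynormD (P t - P' t) (P a - P t).
    rewrite addrC subrKA -[P a - P t]opprB polynormN.
    by move=> *; lra.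
  rewrite (prod_of_root_mset _ _ P'tm (g'P t t01)) root_prod_XsubC.
  by apply: map_f; rewrite mem_enum.
have key (x y : R) j : x <= y -> x \in `[0, 1] -> y \in `[0, 1] ->
    `|a - x| < eta -> `|a - y| < eta -> normc (g' j y - g' j x) < e.
  move=> xy x01 y01 ax ay.
  have sub : `[x, y]%classic `<=` `[0 : R, 1].
    move=> t /=; rewrite !in_itv /= => /andP[xt ty].
    move: x01 y01; rewrite !in_itv /= => /andP[x0 _] /andP[_ y1].
    by rewrite (le_trans x0 xt) (le_trans ty y1).
  apply: (@le_lt_trans _ _ (3 * (e / (3 * n.+1%:R)) * (size s)%:R)).
    apply: path_oscillation => //; first exact: continuous_subspaceW (g'c j).
    move=> t txy; apply: close; first exact: (sub t).
    move: txy ax ay; rewrite in_itv /= !ltr_norml => /andP[? ?].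
    by move=> /andP[? ?] /andP[? ?]; apply/andP; split; lra.
  have -> : 3 * (e / (3 * n.+1%:R)) * (size s)%:R = e * (n%:R / n.+1%:R).
    by rewrite ss; field.
  by rewrite gtr_pMr // ltr_pdivrMr // mul1r ltr_nat.
move=> b j b01 ab; have aa : `|a - a| < eta by rewrite subrr normr0.
have [le_ab|/ltW le_ba] := leP a b; first exact: key.
by rewrite normc_subC; exact: key.
Qed.

(** * Limits along an ultrafilter *)

(** Compactness of [[- B, B]] gives a cluster point. The preimage of a ball around it or the
    complement of that preimage is in [U], and clustering excludes the complement. *)
Lemma ultra_bounded_cvg_real {T : Type} (U : set_system T) (f : T -> R) (B : R) :
  UltraFilter U -> (forall t, `|f t| <= B) -> exists l : R, f @ U --> l.
Proof.
move=> UU fB.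
have [|l [_ fl]] := @segment_compact R (- B) B (f @ U) _.
  by apply: (@filterE T U _ [set t | f t \in `[- B, B]]) => t; rewrite /= in_itv /= -ler_norml.
exists l; apply/cvgrPdist_lt => e e0.
have [//|far] := in_ultra_setVsetC [set t | `|l - f t| < e] UU.
have [y []] := fl (~` [set y | `|l - y| < e]) _ far (nbhsx_ballx l e e0).
by move=> /= /[apply].
Qed.

Lemma ultra_bounded_cvg {T : Type} (U : set_system T) (f : T -> R[i]) (B : R) :
  UltraFilter U -> (forall t, normc (f t) <= B) ->
  exists l : R[i], f @ U --> (l : (R[i] : numFieldType)).
Proof.
move=> UU fB.
have [t|x /cvgrPdist_lt fx] := @ultra_bounded_cvg_real T U (fun t => complex.Re (f t)) B UU.
  apply: le_trans (fB t); case: (f t) => u v /=.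
  by rewrite -sqrtr_sqr ler_wsqrtr // lerDl sqr_ge0.
have [t|y /cvgrPdist_lt fy] := @ultra_bounded_cvg_real T U (fun t => complex.Im (f t)) B UU.
  apply: le_trans (fB t); case: (f t) => u v /=.
  by rewrite -sqrtr_sqr ler_wsqrtr // lerDr sqr_ge0.
exists (x +i* y); apply/cvg_normcP => e e0.
have e20 : 0 < e / 2 by rewrite divr_gt0.
apply: filterS2 (fx _ e20) (fy _ e20) => t; case: (f t) => u v /= xu yv.
rewrite -(ger0_norm (ltW e0)) -sqrtr_sqr ltr_sqrt ?exprn_gt0 //.
rewrite -(real_normK (num_real (x - u))) -(real_normK (num_real (y - v))).
have := normr_ge0 (x - u); have := normr_ge0 (y - v).
by move: `|x - u| `|y - v| xu yv => *; nra.
Qed.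

Lemma cvg_prod_sub {T : Type} {F : set_system T} {FF : Filter F} (n : nat)
    (f : 'I_n -> T -> R[i]) (l : 'I_n -> R[i]) z :
  (forall j, f j @ F --> (l j : (R[i] : numFieldType))) ->
  (fun t => \prod_j (z - f j t)) @ F -->
    (\prod_j (z - l j) : (R[i] : numFieldType)).
Proof.
move=> fl; apply: (@cvg_big (R[i] : numFieldType)) => [|j _].
  exact: mul_continuous.
by apply: cvgB; [exact: cvg_cst|exact: fl].
Qed.

(** In characteristic 0 the integers below [size (p - q)] are distinct roots of [p - q], too many
    for a nonzero polynomial. *)
Lemma poly_horner_inj p q : (forall z, p.[z] = q.[z]) -> p = q.
Proof.
move=> pq; apply/eqP; rewrite -subr_eq0; apply/eqP.
apply: (@roots_geq_poly_eq0 _ _ [seq i%:R | i <- iota 0 (size (p - q))]).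
- by apply/allP => z _; rewrite /root hornerD hornerN pq subrr.
- rewrite map_inj_uniq ?iota_uniq //; exact: mulrIn (oner_neq0 _).
- by rewrite size_map size_iota.
Qed.


(** At each fixed [z] the values [(q t).[z]] tend both to [p.[z]] and to the product of the
    [z - l j]; limits are unique. *)
Lemma roots_of_limit {T : Type} {F : set_system T} {FF : ProperFilter F}
    (n : nat) (p : {poly R[i]}) (q : T -> {poly R[i]})
    (f : 'I_n -> T -> R[i]) (l : 'I_n -> R[i]) :
  size p = n.+1 -> (forall t, q t = \prod_j ('X - (f j t)%:P)) ->
  (forall e : R, 0 < e -> \forall t \near F, polynorm (p - q t) < e) ->
  (forall j, f j @ F --> (l j : (R[i] : numFieldType))) ->
  p = \prod_j ('X - (l j)%:P).
Proof.
move=> sp qE pq fl; apply: poly_horner_inj => z.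
have hornerE_prod (x : 'I_n -> R[i]) :
    (\prod_j ('X - (x j)%:P)).[z] = \prod_j (z - x j).
  by rewrite horner_prod; apply: eq_bigr => j _; rewrite !hornerE.
rewrite hornerE_prod.
apply: (@cvg_unique (R[i] : numFieldType) (@norm_hausdorff _ _)
  ((fun t => \prod_j (z - f j t)) @ F)); last exact: cvg_prod_sub.
apply/cvg_normcP => e e0.
pose B := Num.max 1 (normc z).
have B1 : 1 <= B by rewrite le_max lexx.
have C0 : 0 < n.+1%:R * B ^+ n :> R.
  by rewrite mulr_gt0 // exprn_gt0 // (lt_le_trans ltr01).
have := pq _ (divr_gt0 e0 C0); apply: filterS => t.
rewrite ltr_pdivlMr //; apply: le_lt_trans.
rewrite -hornerE_prod -qE -hornerN -hornerD.
apply: normc_horner_le => //; last by rewrite le_max lexx orbT.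
rewrite (leq_trans (size_polyD _ _)) // size_polyN sp geq_max leqnn /= qE.
by rewrite size_prod_XsubC [index_enum _]unlock -enumT size_enum_ord.
Qed.

(** * Uniform limits of root path sets *)

Lemma root_path_set_ultralimit (n : nat) (P : R -> {poly R[i]})
    (Q : nat -> R -> {poly R[i]}) (g : nat -> 'I_n -> R -> R[i])
    (U : set_system nat) : UltraFilter U -> \oo `<=` U ->
  polynomial_path n P -> (forall k, polynomial_path n (Q k)) ->
  (forall k a, a \in `[0, 1] -> polynorm (P a - Q k a) < k.+1%:R^-1) ->
  (forall k, root_path_set (Q k) (g k)) ->
  exists2 h : 'I_n -> R -> R[i], root_path_set P h &
    forall e : R, 0 < e -> \forall k \near U,
      forall a j, a \in `[0, 1] -> normc (h j a - g k j a) < e.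
Proof.
move=> UU ooU Ppath Qpath PQ gQ.
have small (d : R) : 0 < d -> \forall k \near U, k.+1%:R^-1 < d.
  by move=> d0; apply: ooU; exact: near_infty_natSinv_lt (PosNum d0).
have gE k a : a \in `[0, 1] -> Q k a = \prod_j ('X - (g k j a)%:P).
  move=> a01; have [Qm _] := (Qpath k).1 a a01.
  rewrite (prod_of_root_mset _ _ Qm ((gQ k).2 a a01)).
  by rewrite big_map enumT.
(* The condition on [ja.2] stands under the existential so that choice yields a total function; 0 is
   the default off the interval. *)
have lim_ex (ja : 'I_n * R) : exists l, ja.2 \in `[0, 1] ->
    (fun k => g k ja.1 ja.2) @ U --> (l : (R[i] : numFieldType)).
  case: ja => j a /=.
  have [a01|_] := boolP (a \in `[0, 1]); last by exists 0.
  have [|l] := @ultra_bounded_cvg nat U (fun k => g k j a)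
    (* The root bound is uniform in [k], since [Q k a] is within 1 of [P a]. *)
    (1 + n%:R * (polynorm (P a) + 1)) UU; last by exists l.
  move=> k; have [Qm sQ] := (Qpath k).1 a a01.
  apply: (@le_trans _ _ (1 + n%:R * polynorm (Q k a))).
    apply: normc_root_le => //; rewrite gE //.
    by rewrite (bigD1 j) //= rootM root_XsubC eqxx.
  rewrite lerD2l ler_wpM2l // -[Q k a](subKr (P a)).
  rewrite (le_trans (polynormD _ _)) // polynormN lerD2l.
  by rewrite (le_trans (ltW (PQ k a a01))) // invf_le1 ?ler1n.
have /choice[l lP] := lim_ex.
pose h j a := l (j, a).
have hcvg j a : a \in `[0, 1] ->
    (fun k => g k j a) @ U --> (h j a : (R[i] : numFieldType)).
  exact: (lP (j, a)).
have hclose j a e : a \in `[0, 1] -> 0 < e ->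
    \forall k \near U, normc (h j a - g k j a) < e.
  by move=> a01; have /cvg_normcP := hcvg j a a01; exact.
have equi a e : a \in `[0, 1] -> 0 < e -> exists2 eta : R, 0 < eta &
    \forall k \near U, forall b j, b \in `[0, 1] -> `|a - b| < eta ->
      normc (g k j b - g k j a) < e.
  move=> a01 e0; have [d [eta [d0 eta0 H]]] := root_path_modulus _ _ _ _ Ppath a01 e0.
  exists eta => //; have := small d d0; apply: filterS => k kd b j b01 ab.
  by apply: (H (Q k) (g k)) => // t t01; exact: lt_trans (PQ k t t01) kd.
(* The limits inherit the modulus of [equi]: for given [b] and [j], compare through a single [k]
   that is good at both [a] and [b]. This [k] may depend on [b], but [eta] does not. *)
have hequi a e : a \in `[0, 1] -> 0 < e -> exists2 eta : R, 0 < eta &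
    forall b j, b \in `[0, 1] -> `|a - b| < eta -> normc (h j a - h j b) < e.
  move=> a01 e0; have e30 : 0 < e / 3 by rewrite divr_gt0.
  have [eta eta0 H] := equi a _ a01 e30.
  exists eta => // b j b01 ab.
  have [k [[Hk ka] kb]] := filter_ex (filterI (filterI H (hclose j a _ a01 e30))
    (hclose j b _ b01 e30)).
  have := normc_triangle (g k j a) (h j a) (h j b).
  have := normc_triangle (g k j b) (g k j a) (h j b).
  have := Hk b j b01 ab; move: ka kb.
  rewrite (normc_subC (g k j a) (g k j b)) (normc_subC (g k j b) (h j b)) /=.
  by move=> *; lra.
exists h.
  split=> [j|a a01].
    apply/subspace_continuousP => a a01; apply/cvg_normcP => e e0.
    have [eta eta0 H] := hequi a e a01 e0.
    rewrite near_withinE; apply/nbhs_normP; exists eta => // b ab b01.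
    exact: H.
  have sP := (Ppath.1 a a01).2.
  have -> : P a = \prod_j ('X - (h j a)%:P).
    apply: (@roots_of_limit nat U ultra_proper n _ (Q ^~ a) (fun j k => g k j a)) => //.
    - by move=> k; exact: gE.
    - move=> e e0; have := small e e0; apply: filterS => k.
      exact: lt_trans (PQ k a a01).
    - by move=> j; exact: hcvg.
  by rewrite -root_mset_prod big_map enumT.
move=> e e0; have e30 : 0 < e / 3 by rewrite divr_gt0.
(* Compactness turns pointwise into uniform convergence: it remains to find, around each [a], a
   neighbourhood and a set of [U] on which the bound holds jointly. *)
have /compact_near_coveringP/near_covering_withinP := @segment_compact R 0 1.
move=> /(_ nat U (fun k a => forall j, normc (h j a - g k j a) < e) _) cover.
have : \forall k \near U, `[0 : R, 1]%classic `<=`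
    (fun a => forall j, normc (h j a - g k j a) < e).
  apply: cover => a a01.
  have [eta eta0 H] := equi a _ a01 e30.
  have [eta' eta'0 H'] := hequi a _ a01 e30.
  (* Finitely many indices [j], so the sets of [U] can be intersected. *)
  have ha : \forall k \near U, forall j, normc (h j a - g k j a) < e / 3.
    by apply: filter_forall => j; exact: hclose.
  have near_a : \forall b \near a, `|a - b| < eta /\ `|a - b| < eta'.
    by near=> b; split; near: b; apply/nbhs_normP; [exists eta|exists eta'].
  exists ([set b | `|a - b| < eta /\ `|a - b| < eta'],
    [set k | (forall j, normc (h j a - g k j a) < e / 3) /\
      forall b j, b \in `[0, 1] -> `|a - b| < eta ->
        normc (g k j b - g k j a) < e / 3]) => /=.
    by split=> //; exact: filterI ha H.
  move=> [b k] /= [[ab ab'] [hk gk]] b01 j.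
  have := hk j; have := gk b j b01 ab; have := H' b j b01 ab'.
  have := normc_triangle (h j a) (h j b) (g k j b).
  have := normc_triangle (g k j a) (h j a) (g k j b).
  rewrite (normc_subC (h j b) (h j a)) (normc_subC (g k j a) (g k j b)).
  by move=> *; lra.
by apply: filterS => k hk a j a01; exact: hk.
Unshelve. all: by end_near.
Qed.

End RootPaths.

(** * Contradiction from a sequence of counterexamples *)

Theorem theorem5 (R : realType) (n : nat) (eps : R) (P : R -> {poly R[i]}) :
  0 < eps -> polynomial_path n P ->
  exists2 delta : R, 0 < delta &
    forall P' : R -> {poly R[i]}, polynomial_path n P' ->
    (forall a : R, a \in `[0, 1] -> polynorm (P a - P' a) < delta) ->
    forall g' : 'I_n -> R -> R[i], root_path_set P' g' ->
    exists2 g : 'I_n -> R -> R[i], root_path_set P g &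
      forall (a : R) (j : 'I_n), a \in `[0, 1] ->
        Normc.normc (g j a - g' j a) < eps.
Proof.
move=> eps0 Ppath; apply: contrapT => no_delta.
(* Each [delta] of the form [k.+1%:R^-1] fails, which supplies a counterexample for every [k]. *)
have bad (k : nat) :
    exists Qg : (R -> {poly R[i]}) * ('I_n -> R -> R[i]),
    [/\ polynomial_path n Qg.1,
        forall a, a \in `[0, 1] -> polynorm (P a - Qg.1 a) < k.+1%:R^-1,
        root_path_set Qg.1 Qg.2 &
        ~ exists2 g : 'I_n -> R -> R[i], root_path_set P g &
          forall a j, a \in `[0, 1] -> Normc.normc (g j a - Qg.2 j a) < eps].
  apply: contrapT => no_bad; apply: no_delta; exists k.+1%:R^-1.
    by rewrite invr_gt0.
  move=> P' P'path PP' g' g'P'; apply: contrapT => no_g; apply: no_bad.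
  by exists (P', g').
have /choice[Qg QgP] := bad.
(* Refining [\oo] makes [k.+1%:R^-1] tend to 0 along [U]. *)
have [U [UU ooU]] := ultraFilterLemma (F := \oo%classic) _.
have [|||h hP hclose] := root_path_set_ultralimit R n P (fun k => (Qg k).1)
    (fun k => (Qg k).2) U UU ooU Ppath.
- by move=> k; case: (QgP k).
- by move=> k; case: (QgP k).
- by move=> k; case: (QgP k).
(* One [k] suffices: [h] is then within [eps] of the paths of a counterexample. *)
have [k hk] := filter_ex (hclose eps eps0).
by have [_ _ _] := QgP k; apply; exists h.
Qed.
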